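(* Let $M$ be a Poisson manifold with Poisson bivector $\pi$, let $\mathcal U$ be Kontsevich's $L_\infty$-quasi-isomorphism and let $\ast$ be the associative $\hbar$-linear product on $C^\infty(M)[[\hbar]]$ determined by $\mathcal U$ and $\pi$ (see context). Then for every Poisson vector field $\xi$ on $M$ there exist differential operators $\xi_k$, $k\ge 1$, on $M$ such that the $\hbar$-linear operator $$\Xi=\xi+\hbar\xi_1+\hbar^2\xi_2+\cdots$$ is a derivation of the algebra $(C^\infty(M)[[\hbar]],\ast)$, i.e. $\Xi(f\ast g)=\Xi(f)\ast g+f\ast\Xi(g)$ for all $f,g$.
   Context: $M$ is a smooth compact closed manifold with Poisson bivector $\pi$ and Poisson bracket $\{\cdot,\cdot\}$. A vector field $\xi$ on $M$ is called Poisson if $L_\xi\pi=0$, equivalently $\xi(\{f,g\})=\{\xi(f),g\}+\{f,\xi(g)\}$ for all $f,g\in C^\infty(M)$. Let $\mathfrak g_1=\Gamma(\Lambda^*TM)$ be the graded Lie algebra of polyvector fields (a $p$-vector field has degree $p-1$; zero differential; Schouten bracket). Let $\mathfrak g_2=C^*_{loc}(C^\infty(M))$ be the differential graded Lie algebra of local Hochschild cochains, i.e. polydifferential operators (a $p$-cochain has degree $p-1$; Hochschild differential; Gerstenhaber bracket). Kontsevich's $L_\infty$-quasi-isomorphism is an $L_\infty$-morphism $\mathcal U=\{\mathcal U_n\}:\mathfrak g_1\to\mathfrak g_2$, $\mathcal U_n:\Lambda^n\mathfrak g_1\to\mathfrak g_2$ of degree $1-n$, whose first component $\mathcal U_1=\chi$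 is the Hochschild-Kostant-Rosenberg antisymmetrization map $$\chi(\Phi)(f_1,\dots,f_p)=\frac1{p!}\sum_{\sigma\in S_p}(-1)^\sigma\Phi(df_{\sigma(1)},\dots,df_{\sigma(p)}).$$ It is extended $\hbar$-linearly. The star product is the $\hbar$-linear associative product $$f\ast g=fg+B(f,g),\qquad B=\sum_{k\ge1}\hbar^kB_k=\sum_{n\ge1}\frac{\hbar^n}{n!}\,\mathcal U_n(\pi,\dots,\pi),$$ the Poisson bivector being normalized so that $B_1(f,g)=\chi(\pi)(f,g)=\frac12\{f,g\}$. *)

(* Defs.v *)
From HB Require Import structures.
From mathcomp Require Import all_boot all_order all_algebra perm.
From mathcomp Require Import all_classical all_reals all_analysis.
Set Implicit Arguments.
Unset Strict Implicit.
Unset Printing Implicit Defensive.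
Import Order.TTheory GRing.Theory Num.Theory.
Import numFieldNormedType.Exports.
Local Open Scope classical_set_scope.
Local Open Scope ring_scope.

Section SmoothEuclidean.
Context {R : realType} {n : nat}.
Implicit Types (V : set 'rV[R]_n) (f g : 'rV[R]_n -> R).

Definition partial (i : 'I_n) f : 'rV[R]_n -> R :=
  fun x => 'D_(delta_mx 0 i) f x.

Fixpoint Ck (k : nat) V f : Prop :=
  (forall x, V x -> {for x, continuous f}) /\
  if k is k'.+1 then
    forall i, (forall x, V x -> derivable f x (delta_mx 0 i)) /\
              Ck k' V (partial i f)
  else True.

(* Meaningful for open V only. *)
Definition smooth_on V f : Prop := forall k, Ck k V f.

Lemma Ck_continuous k V f : Ck k V f -> forall x, V x -> {for x, continuous f}.
Proof. by case: k => [|k] []. Qed.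

Lemma CkS k V f : Ck k.+1 V f -> Ck k V f.
Proof.
elim: k f => [|k IH] f [fc fD]; split=> // i.
by have [fi /IH] := fD i.
Qed.

Lemma Ck_eq k V f g : open V -> (forall x, V x -> f x = g x) ->
  Ck k V f -> Ck k V g.
Proof.
move=> oV; elim: k f g => [|k IH] f g fg; move=> [fc fD].
all: have nfg x : V x -> {near x, f =1 g} by
  move=> Vx; apply: filterS (open_nbhs_nbhs (conj oV Vx)) => y; exact: fg.
all: have gc x : V x -> {for x, continuous g} by
  move=> Vx; rewrite /prop_for /continuous_at -(fg x Vx);
  apply: cvg_trans (fc x Vx); apply: (near_eq_cvg (nfg _ Vx)).
- by split.
- split=> // i; have [fi Di] := fD i; split=> [x Vx|].
    exact: near_eq_derivable (nfg _ Vx) (fi x Vx).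
  apply: IH Di => x Vx; apply: near_eq_derive; exact: nfg.
Qed.

Lemma Ck_cst k V (a : R) : Ck k V (cst a).
Proof.
elim: k a => [|k IH] a; split=> //; try by move=> x _; apply: cst_continuous.
move=> i; split=> [x _|]; first exact: derivable_cst.
suff -> : partial i (cst a) = cst 0 by exact: IH.
by apply/funext => x; rewrite /partial derive_cst.
Qed.

Lemma CkD k V f g : open V -> Ck k V f -> Ck k V g -> Ck k V (f + g).
Proof.
move=> oV; elim: k f g => [|k IH] f g [fc fD] [gc gD]; split=> //.
- by move=> x Vx; apply: continuousD; [exact: fc|exact: gc].
- by move=> x Vx; apply: continuousD; [exact: fc|exact: gc].
- move=> i; have [fi Dfi] := fD i; have [gi Dgi] := gD i.
  split=> [x Vx|]; first by apply: derivableD; [exact: fi|exact: gi].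
  apply: Ck_eq (IH _ _ Dfi Dgi) => // x Vx.
  by rewrite /partial deriveD; [|exact: fi|exact: gi].
Qed.

Lemma CkM k V f g : open V -> Ck k V f -> Ck k V g -> Ck k V (f * g).
Proof.
move=> oV; elim: k f g => [|k IH] f g Cf Cg.
  by case: Cf Cg => [fc _] [gc _]; split=> // x Vx;
    apply: continuousM; [exact: fc|exact: gc].
have [fc fD] := Cf; have [gc gD] := Cg; split.
  by move=> x Vx; apply: continuousM; [exact: fc|exact: gc].
move=> i; have [fi Dfi] := fD i; have [gi Dgi] := gD i.
split=> [x Vx|]; first by apply: derivableM; [exact: fi|exact: gi].
have := CkD oV (IH _ _ (CkS Cf) Dgi) (IH _ _ (CkS Cg) Dfi).
apply: Ck_eq => // x Vx.
by rewrite /partial deriveM; [|exact: fi|exact: gi].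
Qed.

End SmoothEuclidean.

Section Manifold.
Context (R : realType) (n : nat) (M : topologicalType).

(* The homeomorphism chart_map : chart_dom -> chart_img is given by total
   functions, irrelevant outside chart_dom and chart_img. *)
Record chart := Chart {
  chart_dom : set M;
  chart_map : M -> 'rV[R]_n;
  chart_inv : 'rV[R]_n -> M;
  chart_img := chart_map @` chart_dom;
  open_chart_dom : open chart_dom;
  open_chart_img : open chart_img;
  chart_mapK : forall x, chart_dom x -> chart_inv (chart_map x) = x;
  chart_map_continuous : forall x, chart_dom x ->
    {for x, continuous chart_map};
  chart_inv_continuous : forall y, chart_img y ->
    {for y, continuous chart_inv}
}.

(* Second countability is not required: it follows from compactness, which is
   assumed separately. *)
Record smooth_manifold := SmoothManifold {
  atlas : set chart;
  manifold_hausdorff : hausdorff_space M;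
  atlas_cover : forall x, exists2 c, atlas c & chart_dom c x;
  atlas_smooth : forall c d, atlas c -> atlas d -> forall i,
    smooth_on (chart_map c @` (chart_dom c `&` chart_dom d))
              (fun y => chart_map d (chart_inv c y) 0 i)
}.

Definition smooth (X : smooth_manifold) : {pred M -> R} :=
  mem [set f : M -> R | forall c, atlas X c ->
                          smooth_on (chart_img c) (f \o chart_inv c)].

Record smooth_fun (X : smooth_manifold) := SmoothFun {
  smooth_val :> M -> R;
  _ : smooth_val \in smooth X
}.

End Manifold.
Arguments chart_img {R n M} c.
Arguments open_chart_img {R n M} c.

Section SmoothFunAlgebra.
Context (R : realType) (n : nat) (M : topologicalType).
Variable X : smooth_manifold R n M.

HB.instance Definition _ := [isSub for @smooth_val R n M X].
HB.instance Definition _ := [Choice of smooth_fun X by <:].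

Lemma smooth_subring_closed : subring_closed (smooth X).
Proof.
have cstP (a : R) : cst a \in smooth X.
  by apply/mem_set => c Xc k; exact: Ck_cst.
have DP f g : f \in smooth X -> g \in smooth X -> f + g \in smooth X.
  move=> /set_mem fS /set_mem gS; apply/mem_set => c Xc k.
  exact: (CkD (open_chart_img c) (fS c Xc k) (gS c Xc k)).
have MP f g : f \in smooth X -> g \in smooth X -> f * g \in smooth X.
  move=> /set_mem fS /set_mem gS; apply/mem_set => c Xc k.
  exact: (CkM (open_chart_img c) (fS c Xc k) (gS c Xc k)).
split=> //; first exact: cstP.
move=> f g fS gS; apply: (DP) => //.
by rewrite -mulN1r; apply: MP => //; exact: (cstP (-1)).
Qed.

HB.instance Definition _ :=
  GRing.isSubringClosed.Build (M -> R) (smooth X) smooth_subring_closed.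

HB.instance Definition _ :=
  GRing.SubChoice_isSubComPzRing.Build _ _ (smooth_fun X) (subringClosedP _).

Lemma smooth_scaler_closed : scaler_closed (smooth X).
Proof.
move=> a f /set_mem fS; apply/mem_set => c Xc k.
exact: (CkM (open_chart_img c) (Ck_cst k _ a) (fS c Xc k)).
Qed.

HB.instance Definition _ :=
  GRing.isScaleClosed.Build R (M -> R) (smooth X) smooth_scaler_closed.

HB.instance Definition _ := [SubZmodule_isSubLmodule of smooth_fun X by <:].

End SmoothFunAlgebra.

Section Cochains.
Context {R : realType} {n : nat} {M : topologicalType}.
Variable X : smooth_manifold R n M.
Local Notation A := (smooth_fun X).

(* An operator A^p -> A of arity p is a function on sequences which vanishes on
   the sequences of length other than p. *)
Definition cochain := seq A -> A.

Implicit Types (D E P Q : cochain) (s t : seq A).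

Definition of_arity (p : nat) D := forall s, size s != p -> D s = 0.

Definition multilinear D := forall s t (a : R) (f g : A),
  D (s ++ (a *: f + g) :: t) = a *: D (s ++ f :: t) + D (s ++ g :: t).

Definition alternating_op D := forall s t (f g : A),
  D (s ++ f :: g :: t) = - D (s ++ g :: f :: t).

Definition local_expr (c : chart R n M) (f : A) : 'rV[R]_n -> R :=
  smooth_val f \o chart_inv c.

(* P(f_1, ..., f_p) stands for P(df_1, ..., df_p).  In a chart,
   P = \sum_i a_i d_{i 1} (x) ... (x) d_{i p} with smooth coefficients a_i;
   these are skew-symmetric in i as P is alternating.
   Decomposable polyvectors are thus normalised by
   (X_1 /\ ... /\ X_p)(df_1, ..., df_p) = det (X_i f_j) / p!. *)
Definition polyvector (p : nat) P : Prop :=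
  [/\ of_arity p P, multilinear P, alternating_op P &
   forall c, atlas X c ->
   exists a : {ffun 'I_p -> 'I_n} -> 'rV[R]_n -> R,
     (forall i, smooth_on (chart_img c) (a i)) /\
     forall s, size s = p -> forall x, chart_img c x ->
       local_expr c (P s) x =
       \sum_i a i x * \prod_(k < p) partial (i k) (local_expr c s`_k) x].

(* al is a multi-index with entries less than N. *)
Definition mpartial N (al : {ffun 'I_n -> 'I_N}) (f : 'rV[R]_n -> R) :=
  foldr (fun i h => iter (al i) (partial i) h) f (enum 'I_n).

(* In a chart, D(f_1, ..., f_p) is a finite sum
   \sum_al a_al d^{al 1} f_1 ... d^{al p} f_p with smooth coefficients. *)
Definition polydiff (p : nat) D : Prop :=
  [/\ of_arity p D, multilinear D &
   forall c, atlas X c ->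
   exists N (a : {ffun 'I_p -> {ffun 'I_n -> 'I_N}} -> 'rV[R]_n -> R),
     (forall al, smooth_on (chart_img c) (a al)) /\
     forall s, size s = p -> forall x, chart_img c x ->
       local_expr c (D s) x =
       \sum_al a al x * \prod_(k < p) mpartial (al k) (local_expr c s`_k) x].

Definition cochain1 (D : A -> A) : cochain :=
  fun s => if s is [:: f] then D f else 0.

Definition diff_op (D : A -> A) := polydiff 1 (cochain1 D).

Definition vector_field (xi : A -> A) := polyvector 1 (cochain1 xi).

(* D o E = \sum_i (-1)^(i (q - 1)) D(f_1, ..., f_i, E(...), ...);
   p.+1 and q.+1 have the parity of the degrees p - 1 and q - 1, also when
   p = 0 or q = 0. *)
Definition gcirc (p q : nat) D E : cochain := fun s =>
  \sum_(i < p) (-1) ^+ (i * q.+1) *: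
     D (take i s ++ E (take q (drop i s)) :: drop (i + q) s).

Definition gerstenhaber (p q : nat) D E : cochain := fun s =>
  if size s == (p + q).-1 then
    gcirc p q D E s - (-1) ^+ (p.+1 * q.+1) *: gcirc q p E D s
  else 0.

Definition mu : cochain := fun s => if s is [:: f; g] then f * g else 0.

(* In the dg Lie algebra the differential is [mu, .], that is (-1)^(p - 1)
   times f_0 D(f_1, ...) - D(f_0 f_1, ...) + ... *)
Definition hochschild (p : nat) D : cochain := gerstenhaber 2 p mu D.

(* The Schouten bracket, extending the Lie bracket of vector fields and
   [xi, f] = xi(f) as a graded biderivation of the wedge product.  Since a
   wedge product is here the antisymmetrisation (with the factor 1/p!) of the
   tensor product, so is the bracket: with the usual normalisation, in which
   polyvectors of degree p - 1 are multiplied by p!, the formula below is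
   the sum over shuffles of P(Q(...), ...) -/+ Q(P(...), ...). *)
Definition schouten (p q : nat) P Q : cochain := fun s =>
  let m := (p + q).-1 in
  if size s == m then
    (m`!%:R)^-1 *: \sum_(sg : 'S_m) (-1) ^+ sg *:
      let t := [seq s`_(sg i) | i <- enum 'I_m] in
      (p%:R *: P (Q (take q t) :: drop q t)
       - (-1) ^+ (p.+1 * q.+1) *: (q%:R *: Q (P (take p t) :: drop p t)))
  else 0.

Definition hkr (p : nat) P : cochain := fun s =>
  if size s == p then
    (p`!%:R)^-1 *: \sum_(sg : 'S_p) (-1) ^+ sg *:
      P [seq s`_(sg i) | i <- enum 'I_p]
  else 0.

(* A homogeneous element, paired with its arity. *)
Definition hpoly := (nat * cochain)%type.
Implicit Types (gs : seq hpoly) (U : seq hpoly -> cochain).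

Fixpoint polyvectors gs : Prop :=
  if gs is g :: gs' then polyvector g.1 g.2 /\ polyvectors gs' else True.

Definition arity gs := sumn (unzip1 gs).

(* The arity of U_n(g_1, ..., g_n), as U_n has degree 1 - n and an element of
   arity p has degree p - 1; when this is negative, i.e. arity gs + 2 < 2 n,
   U_n(g_1, ..., g_n) must vanish. *)
Definition out_arity gs := (arity gs + 2 - 2 * size gs)%N.

(* The Koszul sign (as an exponent) of the unshuffle g_1 ... g_n ->
   (mask m gs) (mask (negb m) gs), for the grading of g_1[1], where g_1 is
   the graded Lie algebra of polyvector fields: the parity of a polyvector
   field in g_1[1] is that of its arity. *)
Definition koszul (m : bitseq) gs : nat :=
  (\sum_(j < size gs) \sum_(i < j)
     (~~ nth false m i && nth false m j) *
     nth 0 (unzip1 gs) i * nth 0 (unzip1 gs) j)%N.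

(* The decalage: the graded symmetric maps S^n(g_1[1]) -> g_2[1] of degree 0
   corresponding to U_n : Lambda^n g_1 -> g_2, where g_2 consists of the
   polydifferential operators.  The sign is trivial on bivector fields. *)
Definition decalage U gs : cochain :=
  (-1) ^+ (\sum_(i < size gs) (size gs - i.+1) * nth 0%N (unzip1 gs) i)%N
    *: U gs.

(* The term F([g_i, g_j], remaining g's), for ij = [:: g_i; g_j]. *)
Definition bracket_term U (ij rest : seq hpoly) : cochain :=
  if ij is [:: g; h] then
    (-1) ^+ g.1 *:
    decalage U (((g.1 + h.1).-1, schouten g.1 h.1 g.2 h.2) :: rest)
  else 0.

(* U represents the family U_n, n >= 1, through its values on sequences of
   length n of homogeneous polyvector fields; other values are irrelevant.
   The last field states that decalage U intertwines the codifferentials Q of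
   S(g_1[1]) and S(g_2[1]) given by Q_1(x) = dx and
   Q_2(x, y) = (-1)^|x| [x, y], |x| being the degree in g[1]; unshuffles of
   gs are described by bit masks. *)
Record Linfty_morphism U : Prop := {
  Linfty_polydiff : forall gs, (0 < size gs)%N -> polyvectors gs ->
    polydiff (out_arity gs) (U gs);
  Linfty_deg_lt0 : forall gs, polyvectors gs ->
    (arity gs + 2 < 2 * size gs)%N -> U gs = 0;
  Linfty_linear : forall gs hs p (a : R) P Q,
    polyvectors gs -> polyvectors hs -> polyvector p P -> polyvector p Q ->
    U (gs ++ (p, a *: P + Q) :: hs) =
    a *: U (gs ++ (p, P) :: hs) + U (gs ++ (p, Q) :: hs);
  Linfty_skew : forall gs hs g h, polyvectors (gs ++ g :: h :: hs) ->
    U (gs ++ g :: h :: hs) =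
    - ((-1) ^+ (g.1.+1 * h.1.+1) *: U (gs ++ h :: g :: hs));
  Linfty_eq : forall gs, (0 < size gs)%N -> polyvectors gs ->
    hochschild (out_arity gs) (decalage U gs) +
    2^-1 *: \sum_(m : (size gs).-tuple bool | (0 < count id m < size gs)%N)
      (let I := mask m gs in let J := mask (map negb m) gs in
       (-1) ^+ (koszul m gs + arity I) *:
       gerstenhaber (out_arity I) (out_arity J) (decalage U I) (decalage U J))
    = \sum_(m : (size gs).-tuple bool | count id m == 2)
        (-1) ^+ koszul m gs *:
        bracket_term U (mask m gs) (mask (map negb m) gs)
}.

Definition coboundary (p : nat) D : Prop :=
  if p is p'.+1 then exists2 E, polydiff p' E & D = hochschild p' E
  else D = 0.

(* U_1 induces an isomorphism in cohomology (the differential of g_1 is 0). *)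
Record quasi_iso U : Prop := {
  quasi_iso_inj : forall p P, polyvector p P ->
    coboundary p (U [:: (p, P)]) -> P = 0;
  quasi_iso_surj : forall p D, polydiff p D -> hochschild p D = 0 ->
    exists2 P, polyvector p P & coboundary p (D - U [:: (p, P)])
}.

Record formality_morphism U : Prop := {
  formality_Linfty : Linfty_morphism U;
  formality_quasi_iso : quasi_iso U;
  formality_hkr : forall p P, polyvector p P -> U [:: (p, P)] = hkr p P
}.

Definition poisson_bivector (pi : cochain) : Prop :=
  polyvector 2 pi /\ schouten 2 2 pi pi = 0.

(* pi is normalised by hkr 2 pi (f, g) = {f, g} / 2. *)
Definition poisson_bracket (pi : cochain) (f g : A) : A := 2 *: pi [:: f; g].

Definition poisson_vector_field (pi : cochain) (xi : A -> A) : Prop :=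
  vector_field xi /\
  forall f g, xi (poisson_bracket pi f g) =
    poisson_bracket pi (xi f) g + poisson_bracket pi f (xi g).

(* A[[h]]: f k is the coefficient of h^k. *)
Definition fps := nat -> A.

Definition star_coef U (pi : cochain) (k : nat) (f g : A) : A :=
  if k is 0 then f * g else (k`!%:R)^-1 *: U (nseq k (2, pi)) [:: f; g].

Definition star U (pi : cochain) (f g : fps) : fps := fun m =>
  \sum_(k < m.+1) \sum_(i < (m - k).+1) star_coef U pi k (f i) (g (m - k - i)%N).

(* The h-linear extension of \sum_k h^k D k. *)
Definition hop (D : nat -> A -> A) (f : fps) : fps := fun m =>
  \sum_(k < m.+1) D k (f (m - k)%N).

Definition derivation (prod : fps -> fps -> fps) (T : fps -> fps) : Prop :=
  forall f g, T (prod f g) = prod (T f) g + prod f (T g).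

End Cochains.

(* Main.v *)
(** The corrections are [xi_k = (-1)^k / k! * U_(k+1)(xi, pi, ..., pi)].
    Evaluating the L-infinity relation on [(xi, pi, ..., pi)] kills its right
    hand side, since [[xi, pi] = 0] and [[pi, pi] = 0].  On the left hand side,
    the bracket of [U(xi, pi^j)] and [U(pi^(k - j))] occurs with multiplicity
    [2 'C(k, j)], for the two complementary masks; after the factor [1/2] and
    division by [k!] this is the coefficient of [h^k] in the Leibniz defect of
    [Xi], the Hochschild term contributing the product [f * g] of order 0. *)

Require Import Defs.
From mathcomp Require Import all_boot all_order all_algebra perm.
From mathcomp Require Import all_classical all_reals all_analysis.
Set Implicit Arguments.
Unset Strict Implicit.
Import GRing.Theory Num.Theory.
Local Open Scope classical_set_scope.
Local Open Scope ring_scope.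

(** * Reindexing of convolution sums and of sums over bit masks *)

Lemma sum_conv_assoc (V : nmodType) m (F : nat -> nat -> nat -> V) :
  \sum_(k < m.+1) \sum_(l < (m - k).+1) F k l (m - k - l)%N =
  \sum_(a < m.+1) \sum_(k < a.+1) F k (a - k)%N (m - a)%N.
Proof.
elim: m F => [|m IHm] F; first by rewrite !big_ord1.
(* Both sides run over the triples of sum [m.+1]. Those with first index 0 are split off; the
   induction hypothesis, with the first index shifted, covers the rest. *)
rewrite big_ord_recl [RHS]big_ord_recl [X in _ = X + _]big_ord1 /=.
rewrite (big_ord_recl (m.+1 - 0)) /= -addrA; congr (_ + _).
under [RHS]eq_bigr => a _ do rewrite big_ord_recl.
rewrite big_split /=; congr (_ + _).
exact: (IHm (fun k => F k.+1)).
Qed.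

Lemma sum_conv_rev (V : nmodType) m (F : nat -> nat -> V) :
  \sum_(k < m.+1) F k (m - k)%N = \sum_(k < m.+1) F (m - k)%N k.
Proof.
rewrite (reindex_inj rev_ord_inj); apply: eq_bigr => k _ /=.
by rewrite subSS subKn // -ltnS.
Qed.

Lemma sum_conv_swap (V : nmodType) m (F : nat -> nat -> nat -> V) :
  \sum_(k < m.+1) \sum_(l < (m - k).+1) F k l (m - k - l)%N =
  \sum_(l < m.+1) \sum_(k < (m - l).+1) F k l (m - l - k)%N.
Proof.
rewrite sum_conv_assoc (sum_conv_assoc m (fun l k => F k l)).
by apply: eq_bigr => a _; rewrite (sum_conv_rev a (fun k l => F k l (m - a)%N)).
Qed.

(** Used for masks on [(xi, pi, ..., pi)], where the first bit decides which block receives [xi]. *)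
Lemma sum_tuple_cons (V : nmodType) k (P : pred bitseq) (F : bitseq -> V) :
  \sum_(m : k.+1.-tuple bool | P m) F m =
  \sum_(m : k.-tuple bool | P (true :: m)) F (true :: m) +
  \sum_(m : k.-tuple bool | P (false :: m)) F (false :: m).
Proof.
pose h (bm : bool * k.-tuple bool) := [tuple of bm.1 :: bm.2].
rewrite (reindex h) /=; last first.
  exists (fun m => (thead m, [tuple of behead m])) => [[b m] _|m _].
    by congr (_, _); apply: val_inj.
  by rewrite /h /= -tuple_eta.
rewrite -(pair_big_dep xpredT (fun b (m : k.-tuple bool) => P (b :: m))
  (fun b m => F (b :: m))) /=.
by rewrite big_bool.
Qed.

(** Source of the binomial multiplicities: ['C(k, j)] masks select [j] of the [k] copies of [pi].
    Splitting off the first bit gives Pascal's rule. *)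
Lemma sum_tuple_count (V : nmodType) k (F : nat -> V) :
  \sum_(m : k.-tuple bool) F (count id m) = \sum_(j < k.+1) F j *+ 'C(k, j).
Proof.
elim: k F => [|k IHk] F.
  rewrite big_ord1 bin0 mulr1n (big_pred1 [tuple]) // => m.
  by apply/esym/eqP; exact: tuple0.
rewrite (sum_tuple_cons k (fun _ => true) (fun m => F (count id m))) /=.
under eq_bigr do rewrite add1n; rewrite (IHk (fun j => F j.+1)).
under [X in _ + X]eq_bigr do rewrite add0n; rewrite IHk.
rewrite [RHS]big_ord_recl bin0 mulr1n.
under [X in _ = _ + X]eq_bigr => j _ do rewrite /= binS mulrnDr.
rewrite big_split /= [LHS]addrC addrA; congr (_ + _).
rewrite big_ord_recl bin0 mulr1n; congr (_ + _).
by rewrite [RHS]big_ord_recr /= bin_small // mulr0n addr0.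
Qed.

Lemma even_sum (I : Type) (r : seq I) (P : pred I) (F : I -> nat) :
  (forall i, P i -> ~~ odd (F i)) -> ~~ odd (\sum_(i <- r | P i) F i)%N.
Proof.
move=> ev; elim/big_rec: _ => // i x Pi xev.
by rewrite oddD (negbTE xev) (negbTE (ev i Pi)).
Qed.

Lemma sign_even (R : pzRingType) e : ~~ odd e -> (-1) ^+ e = 1 :> R.
Proof. by move=> /negbTE e0; rewrite -signr_odd e0. Qed.

Lemma count_negb (m : bitseq) : count id (map negb m) = (size m - count id m)%N.
Proof. by rewrite -(count_predC id m) addKn count_map. Qed.

Lemma mask_nseq (T : Type) (x : T) m k :
  size m = k -> mask m (nseq k x) = nseq (count id m) x.
Proof. by elim: m k => [|[] m IHm] [|k] //= [/IHm ->]. Qed.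

(** Translation by the transposition flips every sign, so the sum equals its opposite, and 2 is
    invertible in [R]. *)
Lemma sum_sign_perm2 (R : realType) (V : lmodType R) (H : 'S_2 -> V) :
  (forall s, H (tperm ord0 ord_max * s)%g = H s) ->
  \sum_(s : 'S_2) (-1) ^+ s *: H s = 0.
Proof.
move=> Ht; set S := \sum_(s : _) _.
have SN : S = - S.
  rewrite [LHS](reindex_inj (mulgI (tperm ord0 ord_max))) /= -sumrN.
  apply: eq_bigr => s _; rewrite Ht odd_permM odd_tperm /=.
  by case: (s : bool) => /=; rewrite ?expr0 ?expr1 ?scaleN1r ?scale1r ?opprK.
have : 2 *: S = 0 by rewrite scaler_nat mulr2n {1}SN addNr.
by move/eqP; rewrite scaler_eq0 pnatr_eq0 /= => /eqP.
Qed.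

(** * Multilinear cochains and brackets in low arity *)

Section Cochains.
Variables (R : realType) (n : nat) (M : topologicalType).
Variable X : smooth_manifold R n M.
Local Notation A := (smooth_fun X).
Implicit Types (P Q D E : cochain X).

Lemma multilinearDr D s t (f g : A) : multilinear D ->
  D (s ++ (f + g) :: t) = D (s ++ f :: t) + D (s ++ g :: t).
Proof. by move=> /(_ s t 1 f g); rewrite !scale1r. Qed.

Lemma multilinear0r D s t : multilinear D -> D (s ++ 0 :: t) = 0.
Proof.
by move=> /(_ s t (-1) 0 0); rewrite scaler0 addr0 scaleN1r addNr.
Qed.

Lemma multilinearZr D s t c (f : A) : multilinear D ->
  D (s ++ c *: f :: t) = c *: D (s ++ f :: t).
Proof.
by move=> mD; have := mD s t c f 0; rewrite addr0 multilinear0r // addr0.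
Qed.

Lemma multilinear_mu : multilinear (@mu _ _ _ X).
Proof.
have scaleAl a (f g : A) : a *: f * g = a *: (f * g).
  by apply/val_inj/funext => x; exact/esym/mulrA.
move=> [|u [|v [|w s]]] [|y [|z t]] a f g; rewrite /= ?scaler0 ?addr0 //.
- by rewrite mulrDl scaleAl.
- by rewrite mulrDr mulrC scaleAl [f * u]mulrC.
Qed.

Lemma polyvector0 p : polyvector p (0 : cochain X).
Proof.
split=> [||s t f g|c Xc] //.
- by move=> s t a f g; rewrite scaler0 addr0.
- by rewrite oppr0.
exists (fun=> cst 0); split=> [i k|s _ x _]; first exact: Ck_cst.
by rewrite big1 // => i _; rewrite mul0r.
Qed.

(** Absorbs the decalage sign and the factor [1/k!] of the corrections. *)
Lemma polydiffZ p c D : polydiff p D -> polydiff p (c *: D).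
Proof.
move=> [aD mD lD]; split.
- by move=> s /aD Ds; rewrite [LHS](_ : _ = c *: D s) // Ds scaler0.
- move=> s t a f g; rewrite [LHS](_ : _ = c *: D (s ++ (a *: f + g) :: t)) //.
  by rewrite mD scalerDr !scalerA mulrC -scalerA.
move=> e Xe; have [N [a [sa Da]]] := lD e Xe.
exists N, (fun al x => c * a al x); split=> [al k|s ss x ex].
  exact: CkM (open_chart_img e) (Ck_cst k _ c) (sa al k).
rewrite [LHS](_ : _ = c * local_expr e (D s) x) // Da // mulr_sumr.
by apply: eq_bigr => al _; rewrite mulrA.
Qed.

(** The bracket is the Leibniz defect of [D] for the product [E]; as a 1-cochain has degree 0, no
    Koszul sign appears. *)
Lemma gerstenhaber12E D E (f g : A) : gerstenhaber 1 2 D E [:: f; g] =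
  D [:: E [:: f; g]] - E [:: D [:: f]; g] - E [:: f; D [:: g]].
Proof.
rewrite /gerstenhaber /gcirc /= big_ord_recl !big_ord0 !big_ord_recl big_ord0.
rewrite /= !expr0 !scale1r !addr0 /bump /= !sqrrN !expr1n !scale1r.
have -> : (-1) ^+ (2 * 3) = 1 :> R by rewrite -signr_odd.
by rewrite scale1r opprD addrA.
Qed.

Lemma gerstenhaber21E D E (f g : A) :
  gerstenhaber 2 1 E D [:: f; g] = - gerstenhaber 1 2 D E [:: f; g].
Proof.
rewrite /gerstenhaber /=.
have -> : (-1) ^+ (2 * 3) = 1 :> R by rewrite -signr_odd.
by rewrite !scale1r opprB.
Qed.

(** By the Poisson condition, [xi(pi(a, b)) - 2 pi(xi a, b)] equals [pi(a, xi b) - pi(xi a, b)]. As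
    [pi] is alternating, this is symmetric in [a] and [b], so its antisymmetrisation vanishes. *)
Lemma schouten_vector_bivector pi (xi : A -> A) :
  polyvector 2 pi -> poisson_vector_field pi xi ->
  schouten 1 2 (cochain1 xi) pi = 0.
Proof.
move=> [_ _ alt_pi _] [[_ lin_xi _ _] xiP].
have xiZ c f : xi (c *: f) = c *: xi f.
  exact: (multilinearZr [::] [::] c f (D := cochain1 xi)).
have xi_pi f g : xi (pi [:: f; g]) = pi [:: xi f; g] + pi [:: f; xi g].
  have := xiP f g; rewrite /poisson_bracket xiZ -scalerDr.
  by apply: scalerI; rewrite pnatr_eq0.
apply/funext => s; rewrite /schouten /=; case: ifP => // _.
pose H (sg : 'S_2) := - (pi [:: xi s`_(sg ord0); s`_(sg ord_max)] +
                         pi [:: xi s`_(sg ord_max); s`_(sg ord0)]).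
rewrite (eq_bigr (fun sg : 'S_2 => (-1) ^+ sg *: H sg)) => [|sg _].
  rewrite (sum_sign_perm2 (H := H)) ?scaler0 // => sg.
  by rewrite /H !permM tpermL tpermR addrC.
rewrite !enum_ordSl enum_ord0 /=.
have -> : lift ord0 ord0 = ord_max :> 'I_2 by apply/val_inj.
have -> : (-1) ^+ (2 * 3) = 1 :> R by rewrite -signr_odd.
rewrite !scale1r xi_pi scaler_nat mulr2n opprD addrACA subrr add0r.
by rewrite (alt_pi [::] [::]) /H opprD addrC.
Qed.

Lemma hkr1 (xi : A -> A) : hkr 1 (cochain1 xi) = cochain1 xi.
Proof.
apply/funext => -[|f [|g s]] //.
rewrite /hkr /= invr1 scale1r (big_pred1 (1%g : 'S_1)) => [|s]; last first.
  by rewrite (permS1 s) /= eqxx.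
by rewrite odd_perm1 scale1r enum_ordSl enum_ord0 /= perm1.
Qed.

End Cochains.

(** * The L-infinity relation on [(xi, pi, ..., pi)] *)

Section PoissonDerivation.
Variables (R : realType) (n : nat) (M : topologicalType).
Variable X : smooth_manifold R n M.
Local Notation A := (smooth_fun X).
Variables (pi : cochain X) (U : seq (hpoly X) -> cochain X) (xi : A -> A).
Hypothesis polyvector_pi : polyvector 2 pi.
Hypothesis schouten_pi : schouten 2 2 pi pi = 0.
Hypothesis U_morphism : Linfty_morphism U.
Hypothesis xi_poisson : poisson_vector_field pi xi.
Local Notation gpi := ((2%N, pi) : hpoly X).
Local Notation gxi := ((1%N, cochain1 xi) : hpoly X).

Lemma polyvectors_nseq k : polyvectors (nseq k gpi).
Proof. by elim: k. Qed.

Lemma polyvectors_xi k : polyvectors (gxi :: nseq k gpi).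
Proof. by split; [case: xi_poisson | exact: polyvectors_nseq]. Qed.

Lemma arity_nseq k : arity (nseq k gpi) = k.*2.
Proof. by rewrite /arity /unzip1 map_nseq sumn_nseq mul2n. Qed.

Lemma out_arity_nseq k : out_arity (nseq k gpi) = 2.
Proof. by rewrite /out_arity arity_nseq size_nseq mul2n addKn. Qed.

Lemma arity_xi k : arity (gxi :: nseq k gpi) = k.*2.+1.
Proof. by rewrite -arity_nseq. Qed.

Lemma out_arity_xi k : out_arity (gxi :: nseq k gpi) = 1%N.
Proof.
by rewrite /out_arity arity_xi [size _]/= size_nseq mul2n doubleS addn2 subSnn.
Qed.

Lemma even_nth_unzip1 k i : ~~ odd (nth 0%N (unzip1 (nseq k gpi)) i).
Proof. by rewrite /unzip1 map_nseq nth_nseq; case: ifP. Qed.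

Lemma decalage_nseq k : decalage U (nseq k gpi) = U (nseq k gpi).
Proof.
rewrite /decalage sign_even ?scale1r // even_sum // => i _.
by rewrite oddM negb_and even_nth_unzip1 orbT.
Qed.

(** In every pair [i < j] the later entry is a copy of [pi], of even arity. *)
Lemma koszul_xi m k : ~~ odd (koszul m (gxi :: nseq k gpi)).
Proof.
apply: even_sum => -[[|j] jk] _; first by rewrite big_ord0.
apply: even_sum => i _.
by rewrite oddM negb_and even_nth_unzip1 orbT.
Qed.

Lemma Linfty_zero p rest : polyvectors rest -> U ((p, 0) :: rest) = 0.
Proof.
move=> rest_poly; have p0 := polyvector0 X p.
have := Linfty_linear U_morphism (gs := [::]) (-1) I rest_poly p0 p0.
by rewrite scaler0 addr0 scaleN1r addNr.
Qed.

(** The two selected entries are [xi] and [pi], or two copies of [pi]; either Schouten bracket is 0,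
    and [U] vanishes on a zero entry. *)
Lemma bracket_term_xi_pi m k : size m = k.+1 -> count id m == 2 ->
  bracket_term U (mask m (gxi :: nseq k gpi))
                 (mask (map negb m) (gxi :: nseq k gpi)) = 0.
Proof.
case: m => // b m [sm]; rewrite /= mask_nseq // mask_nseq ?size_map //.
have schouten_xi := schouten_vector_bivector polyvector_pi xi_poisson.
case: b => /=; [rewrite add1n eqSS|rewrite add0n] => /eqP -> /=.
  rewrite schouten_xi /decalage Linfty_zero ?scaler0 //.
  exact: polyvectors_nseq.
rewrite schouten_pi /decalage Linfty_zero ?scaler0 //; exact: polyvectors_xi.
Qed.

(** The decalage sign is [(-1)^k]: only [xi] has odd arity, and [k] entries follow it. *)
Definition xi_op k := decalage U (gxi :: nseq k gpi).
(** This is [k!] times the coefficient of [h^k] in the star product. Setting the value at 0 to [mu]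
    turns the Hochschild differential into one more bracket of the same family. *)
Definition star_op k := if k is 0 then @mu _ _ _ X else U (nseq k gpi).

Definition mask_term m (gs : seq (hpoly X)) : cochain X :=
  let I := mask m gs in let J := mask (map negb m) gs in
  (-1) ^+ (koszul m gs + arity I) *:
  gerstenhaber (out_arity I) (out_arity J) (decalage U I) (decalage U J).

Lemma star_op_gt0 k : (0 < k)%N -> star_op k = U (nseq k gpi).
Proof. by case: k. Qed.

(** The minus sign is [(-1)^(arity I)]: the first block contains [xi], so its arity is odd. *)
Lemma mask_term_true m k f g : size m = k -> (count id m < k)%N ->
  mask_term (true :: m) (gxi :: nseq k gpi) [:: f; g] =
  - gerstenhaber 1 2 (xi_op (count id m)) (star_op (k - count id m)) [:: f; g].
Proof.
move=> sm jk; rewrite star_op_gt0 ?subn_gt0 // /mask_term.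
rewrite (_ : mask _ _ = gxi :: nseq (count id m) gpi); last first.
  by rewrite -(mask_nseq _ sm).
rewrite (_ : mask _ _ = nseq (k - count id m) gpi); last first.
  by rewrite -sm -count_negb -(mask_nseq _ (size_map _ _)) sm.
rewrite out_arity_xi out_arity_nseq decalage_nseq arity_xi.
rewrite exprD exprS !sign_even ?koszul_xi ?odd_double // mul1r mulr1.
by rewrite scaleN1r.
Qed.

(** The first block now has even arity; the minus sign comes from exchanging the arguments of the
    bracket. Complementary masks thus contribute equally. *)
Lemma mask_term_false m k f g : size m = k -> (0 < count id m)%N ->
  mask_term (false :: m) (gxi :: nseq k gpi) [:: f; g] =
  - gerstenhaber 1 2 (xi_op (k - count id m)) (star_op (count id m)) [:: f; g].
Proof.
move=> sm j0; rewrite star_op_gt0 // /mask_term.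
rewrite (_ : mask _ _ = nseq (count id m) gpi); last first.
  by rewrite -(mask_nseq _ sm).
rewrite (_ : mask _ _ = gxi :: nseq (k - count id m) gpi); last first.
  by rewrite -sm -count_negb -(mask_nseq _ (size_map _ _)) sm.
rewrite out_arity_xi out_arity_nseq decalage_nseq arity_nseq.
rewrite exprD !sign_even ?koszul_xi ?odd_double // mul1r scale1r.
by rewrite gerstenhaber21E.
Qed.

(** This is [k!] times the Leibniz rule in order [k]. The term [j = k] is the Hochschild term, the
    others come from the proper masks. *)
Lemma xi_op_star_op k f g : \sum_(j < k.+1)
  gerstenhaber 1 2 (xi_op j) (star_op (k - j)) [:: f; g] *+ 'C(k, j) = 0.
Proof.
pose gs := gxi :: nseq k gpi.
pose L j l := gerstenhaber 1 2 (xi_op j) (star_op l) [:: f; g].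
(* Cut off at [j = k], since both blocks of a mask are nonempty; the sums can then run over all
   masks. *)
pose G j := if (j < k)%N then L j (k - j)%N else 0.
have := Linfty_eq U_morphism (gs := gs) isT (polyvectors_xi k).
rewrite [RHS]big1; last first.
  move=> m m2; rewrite bracket_term_xi_pi ?scaler0 //.
  by rewrite size_tuple /= size_nseq.
rewrite [X in _ *: X](_ : _ = \sum_(m : (size gs).-tuple bool |
  (0 < count id m < size gs)%N) mask_term m gs) //.
rewrite (sum_tuple_cons _ (fun m => 0 < count id m < size gs)%N
  (mask_term ^~ gs)).
move=> /(congr1 (fun D => D [:: f; g])).
rewrite [LHS](_ : _ = hochschild (out_arity gs) (decalage U gs) [:: f; g] +
  2^-1 *: ((\sum_(m : (size (nseq k gpi)).-tuple bool |
               (0 < 1 + count id m < size gs)%N) mask_term (true :: m) gs) [:: f; g] +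
           (\sum_(m : (size (nseq k gpi)).-tuple bool |
               (0 < 0 + count id m < size gs)%N) mask_term (false :: m) gs) [:: f; g])) //.
rewrite !fct_sumE.
have sz : size (nseq k gpi) = k by rewrite size_nseq.
have -> : \sum_(m : (size (nseq k gpi)).-tuple bool |
    (0 < 1 + count id m < size gs)%N) mask_term (true :: m) gs [:: f; g] =
    - \sum_(j < k.+1) G j *+ 'C(k, j).
  rewrite big_mkcond -sumrN -[in RHS]sz; under [RHS]eq_bigr do rewrite -mulNrn.
  rewrite -(sum_tuple_count _ (fun j => - G j)); apply: eq_bigr => -[m] /=.
  rewrite sz => /eqP sm _; rewrite add1n ltnS /G; case: ifP => jk.
    by rewrite mask_term_true.
  by rewrite oppr0.
have -> : \sum_(m : (size (nseq k gpi)).-tuple bool |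
    (0 < 0 + count id m < size gs)%N) mask_term (false :: m) gs [:: f; g] =
    - \sum_(j < k.+1) G j *+ 'C(k, j).
  (* Here [j] copies of [pi] lie in the block without [xi]; the symmetry of the binomials under
     [j -> k - j] gives the same sum as before. The excluded [j = 0] matches [G k = 0]. *)
  rewrite [in RHS](reindex_inj rev_ord_inj) /= big_mkcond -sumrN -[in RHS]sz.
  under [RHS]eq_bigr => j _ do rewrite subSS (bin_sub (leq_ord j)) -mulNrn.
  rewrite -(sum_tuple_count _ (fun j => - G (size (nseq k gpi) - j)%N)).
  apply: eq_bigr => -[m] /=.
  rewrite sz => /eqP sm _; rewrite add0n.
  have mk : (count id m <= k)%N by rewrite -sm count_size.
  rewrite ltnS mk andbT /G; case: posnP => [-> | j0].
    by rewrite subn0 ltnn oppr0.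
  by rewrite mask_term_false // ltn_subrL j0 (leq_trans j0) // subKn.
have half (v : A) : 2^-1 *: (v + v) = v.
  by rewrite -mulr2n -[v *+ 2]scaler_nat scalerA mulVf ?pnatr_eq0 // scale1r.
(* The two equal sums absorb the factor 1/2, and the Hochschild term becomes minus the bracket of
   [xi_op k] with [mu]. *)
rewrite half /hochschild out_arity_xi gerstenhaber21E => /eqP.
rewrite -opprD oppr_eq0 => /eqP E.
rewrite big_ord_recr /= binn subnn addrC -[RHS]E; congr (_ + _).
rewrite big_ord_recr /= [X in _ = _ + X *+ _]/G ltnn mul0rn addr0.
by apply: eq_bigr => j _; rewrite /G ltn_ord.
Qed.

(** * The corrected operator and its derivation property *)

Lemma polydiff_xi_op k : polydiff 1 (xi_op k).
Proof.
rewrite -(out_arity_xi k); apply/polydiffZ.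
exact: Linfty_polydiff (polyvectors_xi k).
Qed.

Lemma multilinear_star_op k : multilinear (star_op k).
Proof.
case: k => [|k]; first exact: multilinear_mu.
by have [] := Linfty_polydiff U_morphism (gs := nseq k.+1 gpi) isT
  (polyvectors_nseq _).
Qed.

Definition xi_coef k (f : A) : A := (k`!%:R)^-1 *: xi_op k [:: f].

Lemma diff_op_xi_coef k : diff_op (xi_coef k).
Proof.
have [arity_xi_op _ _] := polydiff_xi_op k.
rewrite /diff_op (_ : cochain1 _ = (k`!%:R)^-1 *: xi_op k).
  exact/polydiffZ/polydiff_xi_op.
apply/funext => s; rewrite [RHS](_ : _ = (k`!%:R)^-1 *: xi_op k s) //.
by case: s => [|f [|g s]] //=; rewrite arity_xi_op ?scaler0.
Qed.

Lemma star_coefE k f g :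
  star_coef U pi k f g = (k`!%:R)^-1 *: star_op k [:: f; g].
Proof. by case: k => [|k] //; rewrite fact0 invr1 scale1r. Qed.

Lemma xi_coefD k : {morph xi_coef k : f g / f + g}.
Proof.
have [_ lin_xi _] := polydiff_xi_op k => f g.
by rewrite /xi_coef (multilinearDr [::] [::]) // scalerDr.
Qed.

Lemma star_coefDl k g : {morph (star_coef U pi k)^~ g : f f' / f + f'}.
Proof.
move=> f f'; rewrite /= !star_coefE -scalerDr; congr (_ *: _).
exact: (multilinearDr [::] [:: g]) (multilinear_star_op k).
Qed.

Lemma star_coefDr k f : {morph star_coef U pi k f : g g' / g + g'}.
Proof.
move=> g g'; rewrite /= !star_coefE -scalerDr; congr (_ *: _).
exact: (multilinearDr [:: f] [::]) (multilinear_star_op k).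
Qed.

(** The previous relation divided by [k!]: ['C(k, j) / k! = 1 / (j! (k - j)!)] is the product of the
    normalisations of [xi_coef j] and of the star coefficient of order [k - j]. *)
Lemma derivation_coef k f g :
  \sum_(j < k.+1) xi_coef j (star_coef U pi (k - j) f g) =
  \sum_(j < k.+1) star_coef U pi (k - j) (xi_coef j f) g +
  \sum_(j < k.+1) star_coef U pi (k - j) f (xi_coef j g).
Proof.
apply/eqP; rewrite -big_split -subr_eq0 -sumrB /=; apply/eqP.
(* The zero on the right is replaced by the scaled relation, so that both sides can be compared term
   by term. *)
rewrite -[RHS](scaler0 _ (k`!%:R)^-1) -[X in _ = _ *: X](xi_op_star_op k f g).
rewrite scaler_sumr.
apply: eq_bigr => j _; have jk := leq_ord j.
have [_ lin_xi _] := polydiff_xi_op j.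
have lin_star := multilinear_star_op (k - j).
rewrite !star_coefE /xi_coef (multilinearZr [::] [::]) //.
rewrite (multilinearZr [::] [:: g]) // (multilinearZr [:: f] [::]) //.
rewrite gerstenhaber12E /=.
move: (xi_op j [:: star_op _ _]) => a.
move: (star_op _ [:: _; g]) (star_op _ [:: f; _]) => b c.
rewrite !scalerA -!(mulrC (j`!%:R)^-1) -scalerDr -scalerBr opprD addrA.
rewrite -[X in _ = _ *: X]scaler_nat scalerA.
congr (_ *: _); rewrite -(bin_fact jk) !natrM.
have fact_neq0 m : m`!%:R != 0 :> R by rewrite pnatr_eq0 -lt0n fact_gt0.
have bin_neq0 : 'C(k, j)%:R != 0 :> R by rewrite pnatr_eq0 -lt0n bin_gt0.
by rewrite !invfM mulrAC mulVf // mul1r.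
Qed.

(** In degree [m], all sums run over an operator order [k], a star order [l] and the degrees of the
    two arguments, of total [m]. Grouping by [a = k + l] isolates the Leibniz rule in order [a]. *)
Lemma derivation_xi_coef : derivation (star U pi) (hop xi_coef).
Proof.
move=> f g; apply/funext => m.
have morphD0 (h : A -> A) : {morph h : x y / x + y} -> h 0 = 0.
  by move=> hD; apply: (addrI (h 0)); rewrite -hD !addr0.
have sum_xi k := big_morph _ (xi_coefD k) (morphD0 _ (xi_coefD k)).
have sum_starl k h :=
  big_morph _ (star_coefDl k h) (morphD0 _ (star_coefDl k h)).
have sum_starr k h :=
  big_morph _ (star_coefDr k h) (morphD0 _ (star_coefDr k h)).
rewrite [RHS](_ : _ =
  star U pi (hop xi_coef f) g m + star U pi f (hop xi_coef g) m) //.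
rewrite /star /hop.
transitivity (\sum_(a < m.+1) \sum_(i < (m - a).+1) \sum_(k < a.+1)
  xi_coef k (star_coef U pi (a - k) (f i) (g (m - a - i)%N))).
  pose F k l r :=
    \sum_(i < r.+1) xi_coef k (star_coef U pi l (f i) (g (r - i)%N)).
  transitivity (\sum_(k < m.+1) \sum_(l < (m - k).+1) F k l (m - k - l)%N).
    apply: eq_bigr => k _; rewrite sum_xi.
    by apply: eq_bigr => l _; rewrite sum_xi.
  by rewrite sum_conv_assoc; apply: eq_bigr => a _; rewrite exchange_big.
under eq_bigr => a _ do under eq_bigr => i _ do rewrite derivation_coef.
under eq_bigr => a _ do rewrite big_split /=.
rewrite big_split /=; congr (_ + _).
  pose F k l r :=
    \sum_(i < r.+1) star_coef U pi l (xi_coef k (f i)) (g (r - i)%N).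
  transitivity (\sum_(l < m.+1) \sum_(k < (m - l).+1) F k l (m - l - k)%N).
    rewrite -sum_conv_swap sum_conv_assoc.
    by apply: eq_bigr => a _; rewrite exchange_big.
  apply: eq_bigr => l _; rewrite /F.
  (* The operator acts on the first factor, so the degree in [hop xi_coef f] is [k] plus the degree
     taken from [f]. *)
  rewrite (sum_conv_assoc (m - l)
    (fun k i r => star_coef U pi l (xi_coef k (f i)) (g r))).
  apply: eq_bigr => i _; exact/esym/sum_starl.
pose F k l r :=
  \sum_(i < r.+1) star_coef U pi l (f i) (xi_coef k (g (r - i)%N)).
transitivity (\sum_(l < m.+1) \sum_(k < (m - l).+1) F k l (m - l - k)%N).
  rewrite -sum_conv_swap sum_conv_assoc.
  by apply: eq_bigr => a _; rewrite exchange_big.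
apply: eq_bigr => l _; rewrite /F.
(* The operator acts on the second factor, so the degree taken from [f] has to become the outer
   index. *)
rewrite (sum_conv_swap (m - l)
    (fun k i r => star_coef U pi l (f i) (xi_coef k (g r)))).
apply: eq_bigr => i _; exact/esym/sum_starr.
Qed.

End PoissonDerivation.
Local Close Scope ring_scope.

Theorem proposition3p1 (R : realType) (n : nat) (M : topologicalType)
    (X : smooth_manifold R n M) (M_compact : compact [set: M])
    (pi : cochain X) (pi_poisson : poisson_bivector pi)
    (U : seq (hpoly X) -> cochain X) (U_formality : formality_morphism U)
    (xi : smooth_fun X -> smooth_fun X)
    (xi_poisson : poisson_vector_field pi xi) :
  exists Xi : nat -> smooth_fun X -> smooth_fun X,
    [/\ Xi 0 = xi,
        (forall k, (1 <= k)%N -> diff_op (Xi k)) &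
        derivation (star U pi) (hop Xi)].
Proof.
have [[pi2 pi0] [U_morphism _ U_hkr]] := (pi_poisson, U_formality).
exists (xi_coef pi U xi); split=> [|k _|].
(* In order 0 the decalage sign is trivial, and [U_1(xi)] is the antisymmetrisation of [xi] over a
   single argument, that is [xi]. *)
- apply/funext => f; rewrite /xi_coef fact0 invr1 scale1r /xi_op /decalage /=.
  rewrite big_ord1 subnn mul0n expr0 scale1r U_hkr ?hkr1 //.
  exact: xi_poisson.1.
- exact: diff_op_xi_coef.
- exact: derivation_xi_coef.
Qed.
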